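(* As $n \to \infty$, $$ex(n,K_3,C_5) \le \frac{1}{2\sqrt{2}}\,(1+o(1))\, n^{3/2}.$$ That is, there is a function $\varepsilon(n)$ with $\varepsilon(n)\to 0$ as $n\to\infty$ such that for every positive integer $n$, every graph on $n$ vertices that contains no cycle of length five as a subgraph has at most $\frac{1}{2\sqrt{2}}(1+\varepsilon(n))\,n^{3/2}$ triangles.
   Context: Graphs are finite and simple. $ex(n,K_3,C_5)$ denotes the maximum possible number of triangles (copies of $K_3$ as subgraphs) in a graph on $n$ vertices that does not contain a cycle of length five $C_5$ as a (not necessarily induced) subgraph. The $o(1)$ term denotes a quantity depending only on $n$ and tending to $0$ as $n\to\infty$. *)

(* Defs.v *)
From mathcomp Require Import all_boot.

Set Implicit Arguments.
Unset Strict Implicit.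
Unset Printing Implicit Defensive.

Definition simple_graph (T : finType) (e : rel T) : bool :=
  [forall x, forall y, e x y == e y x] && [forall x, ~~ e x x].

(* A copy of C_5 need not be induced: its five vertices are distinct and
   cyclically adjacent, and chords are allowed. *)
Definition C5_free (T : finType) (e : rel T) : bool :=
  ~~ [exists p : 5.-tuple T, ucycleb e p].

(* A copy of K_3 is determined by its vertex set, so copies are counted as
   3-element sets and not as ordered triples. *)
Definition triangles (T : finType) (e : rel T) : {set {set T}} :=
  [set A : {set T} | (#|A| == 3) &&
    [forall x in A, forall y in A, (x != y) ==> e x y]].

Definition set_rel (T : finType) (E : {set T * T}) : rel T :=
  [rel x y | (x, y) \in E].

(* The generalized Turan number ex(n, K_3, C_5); graphs on the vertex set 'I_n
   suffice, see leq_ex_K3_C5 below. *)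
Definition ex_K3_C5 (n : nat) : nat :=
  \max_(E : {set 'I_n * 'I_n} |
          simple_graph (set_rel E) && C5_free (set_rel E))
    #|triangles (set_rel E)|.

Lemma leq_ex_K3_C5 (T : finType) (e : rel T) :
  simple_graph e -> C5_free e -> #|triangles e| <= ex_K3_C5 #|T|.
Proof.
move=> /andP[/forallP es /forallP ei] eC5.
pose E := [set u : 'I_#|T| * 'I_#|T| | e (enum_val u.1) (enum_val u.2)].
have EE x y : set_rel E x y = e (enum_val x) (enum_val y) by rewrite /set_rel /= inE.
have sE : simple_graph (set_rel E).
  apply/andP; split; last by apply/forallP => x; rewrite EE.
  apply/forallP => x; apply/forallP => y; rewrite !EE.
  exact: (forallP (es _)).
have cE : C5_free (set_rel E).
  apply: contra eC5 => /existsP[p /andP[cp up]].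
  apply/existsP; exists (map_tuple enum_val p); apply/andP; split.
    by rewrite cycle_map -(eq_cycle EE).
  by rewrite map_inj_uniq //; apply: enum_val_inj.
have hE : simple_graph (set_rel E) && C5_free (set_rel E) by rewrite sE cE.
apply: (@leq_trans #|triangles (set_rel E)|); last first.
  exact: (@leq_bigmax_cond _ _ (fun E => #|triangles (set_rel E)|) E hE).
rewrite -(card_imset _ (imset_inj enum_rank_inj)).
apply/subset_leq_card/subsetP => _ /imsetP[A + ->].
rewrite !inE => /andP[A3 /forall_inP At].
rewrite card_imset ?A3 /=; last exact: enum_rank_inj.
apply/forall_inP => _ /imsetP[x xA ->]; apply/forall_inP => _ /imsetP[y yA ->].
rewrite EE !enum_rankK (inj_eq enum_rank_inj).
exact: (forall_inP (At x xA)).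
Qed.

(* Main.v *)
(* In a C_5-free graph the triangles group into blocks: each block is either the
   set of triangles on a common edge ("crown") or the four triangles of a K_4.
   A triangle that is not inside a K_4 owns an edge lying in no other triangle,
   and the four triangles of a K_4 are assigned the edges of a triangle with a
   pendant edge.  A 4-cycle formed of assigned edges would have a chord, hence lie
   inside one block, which the assignment excludes.  So there are at most as many
   triangles as edges in some {C_4, C_5}-free graph.

   The bound for {C_4, C_5}-free graphs is due to Erdos and Simonovits.  The second
   neighbourhood of v induces a matching, so the degrees in it sum to at most
   e + n/2; summing over v, the number of walks of length 3 is at most
   n e + O(n^2).  It is at least 6 a^2 e - 2 a^3 n for every a >= 0, and
   a = sqrt(n/2) gives e <= a^3 + O(n), where a^3 = n^(3/2) / (2 sqrt 2). *)
Require Import Defs.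
From mathcomp Require Import all_boot.
From mathcomp Require Import zify.

Set Implicit Arguments.
Unset Strict Implicit.
Unset Printing Implicit Defensive.

(** * From triangles to the edges of a C_4-free subgraph *)

Lemma cards3 (T : finType) (A : {set T}) : #|A| = 3 ->
  exists a b c, [/\ a != b, a != c, b != c & A = [set a; b; c]].
Proof.
move=> A3; have [a aA] : exists a, a \in A by apply/card_gt0P; rewrite A3.
have : #|A :\ a| == 2 by have := cardsD1 a A; rewrite aA A3 add1n => -[<-].
move=> /cards2P[b [c [bc Abc]]]; exists a, b, c.
have := set21 b c; have := set22 b c; rewrite -Abc !inE => /andP[ca _] /andP[ba _].
by split; rewrite // 1?eq_sym // -setUA -Abc setD1K.
Qed.

Section TrianglesToEdges.
Variables (T : finType) (e : rel T).
Hypotheses (e_sym : symmetric e) (e_irr : irreflexive e) (e_C5 : C5_free e).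
Implicit Types (x y z v w a b c d : T) (A B K P : {set T}).

Lemma adj_neq x y : e x y -> x != y.
Proof. by apply: contraTneq => ->; rewrite e_irr. Qed.

Lemma no_C5 a b c d w :
  e a b -> e b c -> e c d -> e d w -> e w a -> uniq [:: a; b; c; d; w] -> False.
Proof.
move=> ab bc cd dw wa U; move/negP: e_C5; apply; apply/existsP.
exists [tuple of [:: a; b; c; d; w]]; rewrite /ucycleb U andbT /=.
by rewrite ab bc cd dw wa.
Qed.

(** * Cliques, and 4-cliques of a C_5-free graph *)

Definition clique K := [forall x in K, forall y in K, (x != y) ==> e x y].

Lemma cliqueP K :
  reflect {in K &, forall x y, x != y -> e x y} (clique K).
Proof.
apply: (iffP forall_inP) => [H x y xK yK xy | H x xK].
  by have /forall_inP/(_ y yK)/implyP := H x xK; apply.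
by apply/forall_inP => y yK; apply/implyP; apply: H.
Qed.

Lemma in_triangles A : (A \in triangles e) = (#|A| == 3) && clique A.
Proof. by rewrite inE. Qed.

Lemma clique_sub A K : A \subset K -> clique K -> clique A.
Proof.
move=> /subsetP sAK /cliqueP K1; apply/cliqueP => x y xA yA.
by apply: K1; apply: sAK.
Qed.

Lemma triangle3 x y z : e x y -> e y z -> e x z -> [set x; y; z] \in triangles e.
Proof.
move=> xy yz xz; rewrite in_triangles; apply/andP; split.
  by rewrite -setUA cardsU1 cards2 !inE negb_or !adj_neq.
apply/cliqueP => a b; rewrite !inE.
by move=> /orP[/orP[]|] /eqP-> /orP[/orP[]|] /eqP->; rewrite ?eqxx // e_sym.
Qed.

(* Two vertices of a 4-clique have no common neighbour outside of it:
   together with the two other vertices of the clique it would close a C_5. *)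
Lemma clique4_absorb K x y z : #|K| = 4 -> clique K -> x \in K -> y \in K ->
  x != y -> e x z -> e y z -> z \in K.
Proof.
move=> K4 /cliqueP cK xK yK xy xz yz; apply: contraT => zK.
have : #|K :\ x :\ y| = 2.
  have := cardsD1 x K; have := cardsD1 y (K :\ x).
  by rewrite !inE xK yK eq_sym xy K4; lia.
move=> /eqP/cards2P[p [q [pq Kpq]]].
have := set21 p q; have := set22 p q; rewrite -Kpq !inE.
move=> /and3P[qy qx qK] /and3P[py px pK].
have zn u : u \in K -> z != u by apply: contraTneq => <-.
have [] := @no_C5 x z y p q xz _ (cK _ _ yK pK _) (cK _ _ pK qK pq) (cK _ _ qK xK qx) _.
- by rewrite e_sym.
- by rewrite eq_sym.
- rewrite /= !inE !negb_or.
  by do ?[apply/andP; split]; rewrite ?zn // eq_sym ?zn.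
Qed.

(** Any further vertex of [K'] is a common neighbour of [x] and [y], so [clique4_absorb] puts it in
    [K]. *)
Lemma clique4_unique K K' x y : #|K| = 4 -> clique K -> #|K'| = 4 -> clique K' ->
  x != y -> x \in K -> y \in K -> x \in K' -> y \in K' -> K = K'.
Proof.
move=> K4 cK K'4 /cliqueP cK' xy xK yK xK' yK'.
apply/esym/eqP; rewrite eqEcard K4 K'4 leqnn andbT; apply/subsetP => z zK'.
have [<-//|xz] := eqVneq x z; have [<-//|yz] := eqVneq y z.
exact: (clique4_absorb K4 cK xK yK xy (cK' _ _ xK' zK' xz) (cK' _ _ yK' zK' yz)).
Qed.

Definition private A P :=
  [forall B in triangles e, (P \subset B) ==> (B == A)].

Lemma privateP A P :
  reflect (forall B, B \in triangles e -> P \subset B -> B = A) (private A P).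
Proof.
apply: (iffP forall_inP) => [H B BT PB | H B BT].
  by apply/eqP; have /implyP := H B BT; apply.
by apply/implyP => PB; apply/eqP; apply: H.
Qed.

(** At least two vertices of [K] lie outside the pair. Deleting either one from [K] leaves a
    triangle containing the pair, and these two triangles differ. *)
Lemma clique4_not_private K A x y : #|K| = 4 -> clique K -> x \in K -> y \in K ->
  private A [set x; y] -> False.
Proof.
move=> K4 cK xK yK /privateP pA.
have tri z : z \in K -> z != x -> z != y -> z \notin A.
  move=> zK zx zy; apply/negP => zA.
  have KzT : K :\ z \in triangles e.
    rewrite in_triangles (clique_sub (subsetDl _ _) cK) andbT.
    by have := cardsD1 z K; rewrite zK K4 add1n => -[<-].
  suff: A = K :\ z by move=> A_; move: zA; rewrite A_ !inE eqxx.
  apply/esym/pA => //; apply/subsetP => u; rewrite !inE.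
  by case/orP=> /eqP->; rewrite eq_sym ?zx ?zy ?xK ?yK.
have AK u : u \in K -> u \in A -> u \in [set x; y].
  by move=> uK; apply: contraTT; rewrite !inE negb_or => /andP[]; apply: tri.
have [z /andP[zK zxy]] : exists z, (z \in K) && (z \notin [set x; y]).
  have /subsetPn[z] : ~~ (K \subset [set x; y]).
    by apply: contraTN isT => /subset_leq_card; rewrite K4 cards2; case: (_ != _).
  by move=> zK zn; exists z; rewrite zK.
have [w /andP[wK]] : exists w, (w \in K) && (w \notin [set z; x; y]).
  have /subsetPn[w] : ~~ (K \subset [set z; x; y]).
    apply: contraTN isT => /subset_leq_card; rewrite K4 -setUA cardsU1 cards2.
    by case: (_ != _); case: (_ \notin _).
  by move=> wK wn; exists w; rewrite wK.
rewrite -setUA !inE !negb_or => /and3P[wz wx wy].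
move: zxy; rewrite !inE negb_or => /andP[zx zy].
have KwT : K :\ w \in triangles e.
  rewrite in_triangles (clique_sub (subsetDl _ _) cK) andbT.
  by have := cardsD1 w K; rewrite wK K4 add1n => -[<-].
have : K :\ w = A.
  apply: pA => //; apply/subsetP => u; rewrite !inE.
  by case/orP=> /eqP->; rewrite eq_sym ?wx ?wy ?xK ?yK.
by move/setP/(_ z); rewrite !inE zK eq_sym wz /= => /esym; apply/negP; apply: tri.
Qed.

(** * Assigning an edge to each triangle *)

Variable x0 : T.
(** The choice depends on [K] alone, so the four triangles of a 4-clique agree on it; [x0] is the
    default value of [nth]. *)
Definition hub K := nth x0 (enum K) 0.
Definition mate K := nth x0 (enum K) 1.

Lemma hub_in K : #|K| = 4 -> hub K \in K.
Proof. by move=> K4; rewrite -mem_enum mem_nth // -cardE K4. Qed.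

Lemma mate_in K : #|K| = 4 -> mate K \in K.
Proof. by move=> K4; rewrite -mem_enum mem_nth // -cardE K4. Qed.

Lemma hub_neq_mate K : #|K| = 4 -> hub K != mate K.
Proof. by move=> K4; rewrite nth_uniq ?enum_uniq // -cardE K4. Qed.

(* The four triangles of a 4-clique [K] get the edges of the triangle avoiding
   [hub K], and the pendant edge from [hub K] to [mate K]. *)
Definition assigned A P : Prop :=
  [/\ #|P| = 2, P \subset A & private A P] \/
  exists d, [/\ d \notin A, clique (d |: A) &
    P = if d == hub (d |: A) then [set d; mate (d |: A)]
        else A :\ hub (d |: A)].

(** If no edge of [A] is private, the edges [ab] and [ac] lie in further triangles with apexes [d]
    and [d']. Distinct apexes would give the 5-cycle [d b c d' a], so a single vertex [d] is
    adjacent to all of [A]. *)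
Lemma assigned_ex A : A \in triangles e -> exists P, assigned A P.
Proof.
rewrite in_triangles => /andP[/eqP A3 cA].
have [/existsP[c /andP[cA' pc]]|/existsPn np] :=
  boolP [exists c, (c \in A) && private A (A :\ c)].
  exists (A :\ c); left; split => //; last exact: subsetDl.
  by have := cardsD1 c A; rewrite cA' A3; lia.
suff [d dA cd] : exists2 d, d \notin A & clique (d |: A).
  by eexists; right; exists d; split.
have nb c : c \in A -> exists2 d, d \notin A & {in A :\ c, forall u, e u d}.
  move=> cA'; have := np c; rewrite cA' /= => /forall_inPn[B].
  rewrite in_triangles => /andP[/eqP B3 /cliqueP cB]; rewrite negb_imply.
  move=> /andP[sB BA].
  have /subsetPn[d dB dA] : ~~ (B \subset A).
    by apply: contra BA => sBA; rewrite eqEcard sBA A3 B3.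
  exists d => // u uA; apply: cB => //; first exact: (subsetP sB).
  by apply: contraNneq dA => <-; move: uA; rewrite inE => /andP[].
have [a [b [c [ab ac bc Aabc]]]] := cards3 A3.
have aA : a \in A by rewrite Aabc !inE eqxx.
have bA : b \in A by rewrite Aabc !inE eqxx orbT.
have cA' : c \in A by rewrite Aabc !inE eqxx !orbT.
have [d dA ed] := nb c cA'; have [d' d'A ed'] := nb b bA.
have da : e a d by apply: ed; rewrite !inE ac aA.
have db : e b d by apply: ed; rewrite !inE bc bA.
have d'a : e a d' by apply: ed'; rewrite !inE ab aA.
have d'c : e c d' by apply: ed'; rewrite !inE eq_sym bc cA'.
have dd' : d = d'.
  apply/eqP; apply: contraT => dd'.
  have ebc : e b c by apply: (cliqueP _ cA).
  have [] := @no_C5 d b c d' a _ ebc d'c _ da; rewrite 1?e_sym //.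
  have nA u v : u \notin A -> v \in A -> u != v by move=> uA; apply: contraTneq => <-.
  rewrite /= !inE !negb_or dd' bc (eq_sym b a) (eq_sym c a) ab ac.
  by rewrite (eq_sym b) (eq_sym c d') !nA.
exists d => //; rewrite -dd' in d'c.
have eA u : u \in A -> e u d by rewrite Aabc !inE => /orP[/orP[]|] /eqP->.
apply/cliqueP => u v; rewrite !inE.
move=> /predU1P[->|uA] /predU1P[->|vA]; rewrite ?eqxx // => uv.
- by rewrite e_sym eA.
- exact: eA.
- exact: (cliqueP _ cA).
Qed.

Lemma assigned_cases A P : A \in triangles e -> assigned A P ->
  #|P| = 2 /\
  ([/\ P \subset A & private A P] \/
   exists K d, [/\ #|K| = 4, clique K, d \in K & A = K :\ d] /\
     (P \subset K /\ P = if d == hub K then [set hub K; mate K] else K :\ d :\ hub K)).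
Proof.
rewrite in_triangles => /andP[/eqP A3 _].
case=> [[P2 sP pP]|[d [dA cK ->]]]; first by split=> //; left.
have K4 : #|d |: A| = 4 by rewrite cardsU1 dA A3.
have AK : A = (d |: A) :\ d by rewrite setU1K.
have sK := hub_in K4; have pK := mate_in K4; have sp := hub_neq_mate K4.
split.
  case: eqVneq => [dh|dh]; first by rewrite cards2 {1}dh sp.
  move: sK; rewrite !inE eq_sym (negPf dh) /= => sA.
  by have := cardsD1 (hub (d |: A)) A; rewrite sA A3; lia.
right; exists (d |: A), d; split; first by rewrite setU11.
rewrite -AK; case: eqVneq => [dh|_]; split=> //;
    last exact: subset_trans (subsetDl _ _) (subsetUr _ _).
  by apply/subsetP => u; rewrite in_set2 => /orP[]/eqP->; rewrite ?setU11.
by rewrite {1}dh.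
Qed.

(** A private edge determines its triangle and lies in no 4-clique. Otherwise both triangles lie in
    the same 4-clique, by [clique4_unique]; there only the pendant edge contains the hub, and any
    other assigned edge misses just the hub and [d]. *)
Lemma assigned_inj A B P : A \in triangles e -> B \in triangles e ->
  assigned A P -> assigned B P -> A = B.
Proof.
move=> AT BT /(assigned_cases AT)[P2 aA] /(assigned_cases BT)[_ aB].
move: (P2) => /eqP/cards2P[x [y [xy Pxy]]].
have xP : x \in P by rewrite Pxy set21.
have yP : y \in P by rewrite Pxy set22.
have inK K : P \subset K -> x \in K /\ y \in K by move=> /subsetP sK; split; apply: sK.
case: aA => [[sA pA]|[K [d [[K4 cK dK ->] [sK PK]]]]].
  case: aB => [[sB _]|[K [d [[K4 cK _ _] [/inK[xK yK] _]]]]].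
    by apply/esym/(privateP _ _ pA).
  by have := clique4_not_private K4 cK xK yK; rewrite -Pxy => /(_ A pA).
have [xK yK] := inK _ sK.
case: aB => [[_ pB]|[K' [d' [[K'4 cK' d'K ->] []]]]].
  by have := clique4_not_private K4 cK xK yK; rewrite -Pxy => /(_ B pB).
move=> /inK[xK' yK'] PK'.
have KK' := clique4_unique K4 cK K'4 cK' xy xK yK xK' yK'.
rewrite -{K' K'4 cK' xK' yK'}KK' in d'K PK' *.
have hK := hub_in K4.
have [dh|dh] := eqVneq d (hub K); have [d'h|d'h] := eqVneq d' (hub K).
- by rewrite dh d'h.
- move: PK PK'; rewrite dh eqxx (negPf d'h) => -> /setP/(_ (hub K)).
  by rewrite !inE eqxx.
- move: PK PK'; rewrite d'h eqxx (negPf dh) => -> /setP/(_ (hub K)).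
  by rewrite !inE eqxx.
- move: PK PK'; rewrite (negPf d'h) (negPf dh) => -> /setP/(_ d).
  by rewrite !inE eqxx dK dh /= andbT => /esym/negbFE/eqP->.
Qed.

(** * The graph of assigned edges *)

Variable f : {set T} -> {set T}.
Hypothesis fP : forall A, A \in triangles e -> assigned A (f A).

Definition thin : rel T := [rel x y | [set x; y] \in f @: triangles e].

Lemma thin_sym : symmetric thin.
Proof. by move=> x y; rewrite /thin /= setUC. Qed.

Lemma thin_cases x y : thin x y -> x != y /\
  ((exists A, [/\ x \in A, y \in A, A \in triangles e, f A = [set x; y]
     & private A [set x; y]]) \/
   exists K, [/\ #|K| = 4, clique K, x \in K, y \in K &
      (x = hub K -> y = mate K)]).
Proof.
move=> /imsetP[A AT xyA].
have [P2 cases] := assigned_cases AT (fP AT); rewrite -xyA in P2 cases.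
have xy : x != y by move: P2; rewrite cards2; case: eqVneq.
split=> //; case: cases => [[/subsetP sA pA]|[K [d [[K4 cK dK AK] [/subsetP sK PK]]]]].
  by left; exists A; split=> //; apply: sA; rewrite !inE eqxx ?orbT.
right; exists K; split=> //; try by apply: sK; rewrite !inE eqxx ?orbT.
move=> xh; move: PK; case: ifP => _ /setP; rewrite xh.
  by move/(_ y); rewrite !inE eqxx orbT -xh eq_sym (negPf xy) => /esym/eqP.
by move/(_ x); rewrite !inE xh eqxx.
Qed.

Lemma thin_sub x y : thin x y -> e x y.
Proof.
move=> /thin_cases[xy [[A [xA yA]]|[K [_ /cliqueP cK xK yK _]]]]; last exact: cK.
by rewrite in_triangles => /andP[_ /cliqueP cA] _ _; apply: cA.
Qed.

(** An edge inside [K] is not private and lies in no other 4-clique, so it was assigned through [K]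
    itself. *)
Lemma thin_hub K v : #|K| = 4 -> clique K -> v \in K -> thin (hub K) v -> v = mate K.
Proof.
move=> K4 cK vK /thin_cases[hv [[A [_ _ _ _ pA]]|[K' [K'4 cK' hK' vK']]]].
  by have [] := clique4_not_private K4 cK (hub_in K4) vK pA.
have <- := clique4_unique K4 cK K'4 cK' hv (hub_in K4) vK hK' vK'.
by apply.
Qed.

(** If [xy] or [yz] was assigned through a 4-clique, absorption along the chord [xz] draws the whole
    cycle into it. Otherwise both edges are private to the triangle [xyz], which has only one
    assigned edge. *)
Lemma thin_chord x y z w : thin x y -> thin y z -> thin z w -> thin w x ->
  x != z -> y != w -> e x z -> False.
Proof.
move=> xy yz zw wx nxz nyw exz.
(* Each of the four vertices has two [thin] neighbours in [K] while the hub has at most one, so the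
   hub would be a fifth vertex of [K]. *)
have in4 K : #|K| = 4 -> clique K -> x \in K -> y \in K -> z \in K -> w \in K -> False.
  move=> K4 cK xK yK zK wK.
  have hK := thin_hub K4 cK.
  have two u v t : u \in K -> v \in K -> u != v -> thin t u -> thin t v -> hub K != t.
    move=> uK vK uv tu tv; apply: contra_neq uv => ht.
    by rewrite -ht in tu tv; rewrite (hK u uK tu) (hK v vK tv).
  have [yx zy wz xw] : [/\ thin y x, thin z y, thin w z & thin x w].
    by split; rewrite thin_sym.
  have nx := two _ _ _ yK wK nyw xy xw.
  have ny := two _ _ _ xK zK nxz yx yz.
  have nz := two _ _ _ yK wK nyw zy zw.
  have nw := two _ _ _ xK zK nxz wx wz.
  have : hub K |: [set x; y; z; w] \subset K.
    apply/subsetP => u; rewrite !inE -!orbA.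
    by case/or4P => [||| /orP[]] /eqP-> //; apply: hub_in.
  move/subset_leq_card; rewrite K4 cardsU1 !inE !negb_or nx ny nz nw /=.
  have -> : #|[set x; y; z; w]| = 4; last by [].
  rewrite setUC cardsU1 -setUA cardsU1 cards2 !inE !negb_or.
  rewrite (adj_neq (thin_sub wx)) (eq_sym w) nyw (eq_sym w) (adj_neq (thin_sub zw)).
  by rewrite (adj_neq (thin_sub xy)) nxz (adj_neq (thin_sub yz)).
have [exy eyz] := (thin_sub xy, thin_sub yz).
have T3 : [set x; y; z] \in triangles e by apply: triangle3.
have ezw := thin_sub zw; have ewx := thin_sub wx.
have [nxy [[A [_ _ _ fA /privateP pA]]|[K [K4 cK xK yK _]]]] := thin_cases xy; last first.
  have zK := clique4_absorb K4 cK xK yK nxy exz eyz.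
  apply: (in4 K) => //.
  by apply: (clique4_absorb K4 cK xK zK nxz); rewrite // e_sym.
have [nyz [[B [_ _ _ fB /privateP pB]]|[K [K4 cK yK zK _]]]] := thin_cases yz; last first.
  have xK : x \in K by apply: (clique4_absorb K4 cK yK zK nyz); rewrite e_sym.
  apply: (in4 K) => //.
  by apply: (clique4_absorb K4 cK xK zK nxz); rewrite // e_sym.
have AB : A = B.
  rewrite -(pA _ T3) -?(pB _ T3) //.
    by apply/subsetP => u; rewrite !inE => /orP[]->; rewrite ?orbT.
  by apply/subsetP => u; rewrite !inE => /orP[]->; rewrite ?orbT.
move: fA; rewrite AB fB => /setP/(_ x); rewrite !inE eqxx (negPf nxz).
by rewrite (negPf nxy).
Qed.

(** The edge [xy] lies in a triangle of [e] with third vertex [t]. If [t] is off the cycle,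
    [x t y z w] is a C_5; if not, the cycle has a chord. *)
Lemma thin_C4 x y z w : thin x y -> thin y z -> thin z w -> thin w x ->
  x != z -> y = w.
Proof.
move=> xy yz zw wx nxz; apply/eqP; apply: contraT => nyw.
have [exy eyz ezw ewx] : [/\ e x y, e y z, e z w & e w x] by split; apply: thin_sub.
suff [t [ext eyt]] : exists t, e x t /\ e y t.
  have [tz|ntz] := eqVneq t z.
    by have [] := thin_chord xy yz zw wx nxz nyw; rewrite -tz.
  have [tw|ntw] := eqVneq t w.
    by have [] := thin_chord yz zw wx xy nyw; rewrite 1?eq_sym // -tw.
  have [] := @no_C5 x t y z w ext _ eyz ezw ewx; first by rewrite e_sym.
  rewrite /= !inE !negb_or ntz ntw nyw nxz !adj_neq // e_sym //.
have [nxy [[A [xA yA]]|[K [K4 cK xK yK _]]]] := thin_cases xy.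
  rewrite in_triangles => /andP[/eqP A3 /cliqueP cA] _ _.
  have /subsetPn[t tA] : ~~ (A \subset [set x; y]).
    by apply: contraTN isT => /subset_leq_card; rewrite A3 cards2; case: (_ != _).
  rewrite !inE negb_or => /andP[tx ty].
  by exists t; split; apply: cA; rewrite // eq_sym.
have /subsetPn[t tK] : ~~ (K \subset [set x; y]).
  by apply: contraTN isT => /subset_leq_card; rewrite K4 cards2; case: (_ != _).
rewrite !inE negb_or => /andP[tx ty].
by exists t; split; apply: (cliqueP _ cK); rewrite // eq_sym.
Qed.

Lemma thin_C5 a b c d w : thin a b -> thin b c -> thin c d -> thin d w ->
  thin w a -> uniq [:: a; b; c; d; w] -> False.
Proof. by do 5![move/thin_sub => ?]; apply: no_C5. Qed.

(** Double counting of incidences between vertices and assigned edges, using that [f] is injective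
    with values of size 2. *)
Lemma card_thin : 2 * #|triangles e| <= \sum_x \sum_y thin x y.
Proof.
have f2 A : A \in triangles e -> #|f A| = 2.
  by move=> AT; have [] := assigned_cases AT (fP AT).
have f_inj : {in triangles e &, injective f}.
  move=> A B AT BT AB; apply: (assigned_inj AT BT (fP AT)).
  by rewrite AB; apply: fP.
rewrite -(card_in_imset f_inj) mulnC -sum_nat_const.
rewrite (eq_bigr (fun P : {set T} => \sum_x (x \in P))); last first.
  by move=> _ /imsetP[A AT ->]; rewrite -(f2 A AT) -sum1_card big_mkcond.
rewrite exchange_big /=; apply: leq_sum => x _.
rewrite -big_mkcondr -[leqRHS]big_mkcond /= !sum1dep_card.
(* The assigned edges at [x] are images of [thin] neighbours of [x]. *)
apply: leq_trans (leq_imset_card (fun y => [set x; y]) _).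
apply/subset_leq_card/subsetP => P; rewrite inE => /andP[/[dup] PF].
case/imsetP => A AT PA xP.
move: (f2 A AT); rewrite -PA => /eqP/cards2P[a [b [ab Pab]]].
move: xP; rewrite Pab !inE => /orP[]/eqP xE.
  by apply/imsetP; exists b; rewrite ?in_set /thin /= xE -?Pab.
by apply/imsetP; exists a; rewrite ?in_set /thin /= xE setUC -?Pab.
Qed.

End TrianglesToEdges.

Lemma triangles_le_edges (T : finType) (e : rel T) :
  simple_graph e -> C5_free e ->
  exists h : rel T, [/\ symmetric h, irreflexive h,
    forall x y z w, h x y -> h y z -> h z w -> h w x -> x != z -> y = w,
    forall a b c d w, h a b -> h b c -> h c d -> h d w -> h w a ->
      uniq [:: a; b; c; d; w] -> False &
    2 * #|triangles e| <= \sum_x \sum_y h x y].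
Proof.
move=> /andP[/forallP es /forallP ei] eC5.
have e_sym : symmetric e by move=> x y; apply/eqP; apply: (forallP (es x)).
have e_irr : irreflexive e by move=> x; apply/negbTE.
(* Without triangles the empty graph serves; otherwise a triangle supplies the default vertex
   [x0]. *)
have [->|[A AT]] := set_0Vmem (triangles e).
  by exists (fun _ _ => false); split=> //; rewrite cards0 muln0.
have [x0 _] : exists x0, x0 \in A.
  by apply/card_gt0P; move: AT; rewrite in_triangles => /andP[/eqP->].
have /fin_all_exists[f fP] : forall A, exists P, A \in triangles e -> assigned e x0 A P.
  move=> B; have [BT|] := boolP (B \in triangles e); last by exists B.
  by have [P] := assigned_ex e_sym eC5 x0 BT; exists P.
exists (thin e f); split.
- exact: thin_sym.
- by move=> x; apply/negP => /(thin_sub eC5 fP); rewrite e_irr.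
- by apply: (thin_C4 e_sym e_irr eC5 fP).
- by apply: (thin_C5 eC5 fP).
- by apply: (card_thin e_sym eC5 fP).
Qed.

(** * Walks of length 3 in a graph without C_4 and C_5 *)

Section Walks.
Variables (T : finType) (h : rel T).
Hypotheses (h_sym : symmetric h) (h_irr : irreflexive h).
Hypothesis h_C4 : forall x y z w,
  h x y -> h y z -> h z w -> h w x -> x != z -> y = w.
Hypothesis h_C5 : forall a b c d w,
  h a b -> h b c -> h c d -> h d w -> h w a -> uniq [:: a; b; c; d; w] -> False.
Implicit Types u v w x y : T.

Definition deg x := \sum_y h x y.
Definition codeg x y := \sum_w h x w * h w y.
Definition second_nbr v u := [&& u != v, ~~ h v u & 0 < codeg v u].

Lemma sum_pred_le1 (p : pred T) :
  {in p &, forall x y, x = y} -> \sum_x (p x : nat) <= 1.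
Proof.
move=> p1; rewrite -big_mkcond /= sum1_card.
by apply/card_le1_eqP => x y px py; apply: p1.
Qed.

Lemma codeg_le1 x y : x != y -> codeg x y <= 1.
Proof.
move=> xy; rewrite /codeg; under eq_bigr do rewrite mulnb.
apply: sum_pred_le1 => w w' /andP[xw wy] /andP[xw' w'y].
by apply: (h_C4 xw wy _ _ xy); rewrite h_sym.
Qed.

Lemma codegxx x : codeg x x = deg x.
Proof. by apply: eq_bigr => w _; rewrite (h_sym w) mulnb andbb. Qed.

Lemma codeg_gt0 x y : 0 < codeg x y -> exists2 w, h x w & h w y.
Proof.
rewrite lt0n sum_nat_eq0 => /forallPn[w]; rewrite mulnb eqb0 negbK.
by move=> /andP[]; exists w.
Qed.

Lemma sum_codeg x : \sum_y codeg x y <= deg x + #|T|.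
Proof.
rewrite (bigD1 x) //= codegxx leq_add2l.
apply: (@leq_trans (\sum_(y | y != x) 1)).
  by apply: leq_sum => y yx; rewrite codeg_le1 // eq_sym.
by rewrite sum1_card max_card.
Qed.

Lemma sum_deg_le : \sum_x deg x <= #|T| * #|T|.
Proof.
rewrite -[leqRHS]sum_nat_const; apply: leq_sum => x _.
by rewrite /deg -big_mkcond /= sum1_card max_card.
Qed.

(** Walks of length 2, counted by their middle vertex and then by their ends. *)
Lemma sum_deg_sq : \sum_v deg v * deg v <= \sum_v deg v + #|T| * #|T|.
Proof.
have -> : \sum_v deg v * deg v = \sum_x \sum_y codeg x y.
  under [RHS]eq_bigr do rewrite exchange_big /=.
  rewrite [RHS]exchange_big /=; apply: eq_bigr => v _.
  rewrite big_distrl /=; apply: eq_bigr => x _.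
  by rewrite big_distrr /= (h_sym v x).
rewrite -[_ * _]sum_nat_const -big_split /=; apply: leq_sum => x _.
exact: sum_codeg.
Qed.

(* The second neighbourhood of [v] induces a matching: an edge between two
   vertices with distinct parents closes a C_5 through [v], and two edges between
   siblings sharing a vertex close a C_4 with the parent. *)
Lemma second_nbr_matching v u : second_nbr v u ->
  \sum_(w | second_nbr v w) h u w <= 1.
Proof.
move=> Nu; rewrite big_mkcond /=.
rewrite (eq_bigr (fun w => second_nbr v w && h u w : nat)); last first.
  by move=> w _; case: ifP.
have parent x q r : second_nbr v x -> h u x -> h v q -> h q u -> h v r -> h r x ->
    q = r.
  move=> /and3P[xv vx _] ux vq qu vr rx; apply/eqP; apply: contraT => qr.
  move: Nu => /and3P[uv vu _].
  have [xr rv] : h x r /\ h r v by rewrite !(h_sym _ r) (h_sym r v).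
  have [] := h_C5 vq qu ux xr rv.
  have nh a b : h a b -> a != b by apply: contraTneq => ->; rewrite h_irr.
  have nvh a b : h v a -> ~~ h v b -> a != b by move=> va; apply: contraNneq => <-.
  rewrite /= !inE !negb_or (nh _ _ vq) (nh _ _ vr) (nh _ _ qu) (nh _ _ ux) qr.
  rewrite (eq_sym v u) (eq_sym v x) uv xv (nvh _ _ vq vx).
  by rewrite (eq_sym u r) (nvh _ _ vr vu) (eq_sym x r) (nh _ _ rx).
apply: sum_pred_le1 => a b /andP[Na ua] /andP[Nb ub].
have /codeg_gt0[q vq qu] : 0 < codeg v u by case/and3P: Nu.
have /codeg_gt0[r vr ra] : 0 < codeg v a by case/and3P: Na.
have /codeg_gt0[s vs sb] : 0 < codeg v b by case/and3P: Nb.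
have qr := parent a q r Na ua vq qu vr ra; have qs := parent b q s Nb ub vq qu vs sb.
rewrite -qr in ra; rewrite -qs in sb.
apply: (h_C4 ua _ sb) => //; try by rewrite h_sym.
by apply: contraTneq qu => ->; rewrite h_irr.
Qed.

Lemma sum_deg_second_nbr v :
  2 * \sum_(u | second_nbr v u) deg u <= #|T| + \sum_u deg u.
Proof.
(* One copy of the sum cancels. The other splits into edges inside the second neighbourhood, at most
   one per vertex, and edges leaving it, which are paid for by the degrees outside. *)
rewrite (bigID (second_nbr v) predT) /= mul2n -addnn addnCA leq_add2l.
have -> : \sum_(u | second_nbr v u) deg u =
    \sum_(u | second_nbr v u) \sum_(w | second_nbr v w) h u w +
    \sum_(u | second_nbr v u) \sum_(w | ~~ second_nbr v w) h u w.
  by rewrite -big_split /=; apply: eq_bigr => u _; rewrite /deg (bigID (second_nbr v)).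
apply: leq_add.
  apply: (@leq_trans (\sum_(u | second_nbr v u) 1)).
    by apply: leq_sum => u; apply: second_nbr_matching.
  by rewrite sum1_card max_card.
rewrite exchange_big /=; apply: leq_sum => w _.
rewrite /deg [leqRHS](bigID (second_nbr v)) /=.
by apply: leq_trans (leq_addr _ _); apply: leq_sum => u _; rewrite h_sym.
Qed.

(** Walks of length 3 from [v], sorted by their third vertex [u]: it is [v], a neighbour, or a
    second neighbour. Off the diagonal [codeg] is at most 1. *)
Lemma walks_from v : \sum_u codeg v u * deg u <=
  deg v * deg v + \sum_u h v u * deg u + \sum_(u | second_nbr v u) deg u.
Proof.
rewrite (bigD1 v) //= codegxx -addnA leq_add2l big_mkcond /=.
rewrite [X in _ <= _ + X]big_mkcond /= -big_split /=; apply: leq_sum => u _.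
case: ifP => // uv; have := codeg_le1 (x := v) (y := u); rewrite eq_sym uv.
move=> /(_ isT); rewrite /second_nbr uv /=.
case: (h v u) => /=; first by nia.
by case: posnP => [->//|]; nia.
Qed.

Lemma walks3_le :
  2 * \sum_w \sum_u h w u * (deg w * deg u) <=
  #|T| * \sum_x deg x + 9 * (#|T| * #|T|).
Proof.
have -> : \sum_w \sum_u h w u * (deg w * deg u) = \sum_v \sum_u codeg v u * deg u.
  (* The same walks of length 3, counted by their middle edge and by their first vertex. *)
  transitivity (\sum_v \sum_u \sum_w h v w * h w u * deg u).
    under [RHS]eq_bigr do rewrite exchange_big /=.
    rewrite [RHS]exchange_big /=; apply: eq_bigr => w _.
    rewrite [RHS]exchange_big /=; apply: eq_bigr => u _.
    rewrite mulnCA big_distrl /=; apply: eq_bigr => v _.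
    by rewrite (h_sym w v) mulnA.
  by apply: eq_bigr => v _; apply: eq_bigr => u _; rewrite big_distrl.
have H1 : \sum_v \sum_u codeg v u * deg u <= \sum_v deg v * deg v +
   \sum_v \sum_u h v u * deg u + \sum_v \sum_(u | second_nbr v u) deg u.
  by rewrite -!big_split /=; apply: leq_sum => v _; apply: walks_from.
have H2 : \sum_v \sum_u h v u * deg u = \sum_v deg v * deg v.
  rewrite exchange_big /=; apply: eq_bigr => u _; rewrite -big_distrl /=.
  by congr (_ * _); apply: eq_bigr => v _; rewrite h_sym.
have H3 : 2 * \sum_v \sum_(u | second_nbr v u) deg u <=
    #|T| * (#|T| + \sum_u deg u).
  rewrite big_distrr /= -[leqRHS]sum_nat_const; apply: leq_sum => v _.
  exact: sum_deg_second_nbr.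
(* The term 4 times the sum of squared degrees costs at most 8 [#|T|]^2, and [H3] adds one more:
   hence 9. *)
have := sum_deg_le; have := sum_deg_sq; nia.
Qed.

End Walks.

(** * The asymptotic bound *)

From mathcomp Require Import all_order all_algebra.
From mathcomp Require Import all_classical all_reals all_analysis.
From mathcomp Require Import ring lra.
Import Order.TTheory GRing.Theory Num.Theory.
Import numFieldNormedType.Exports.
Local Open Scope classical_set_scope.
Local Open Scope ring_scope.

(* The AM-GM inequality for [x * y], [a ^+ 3 / x] and [a ^+ 3 / y]. *)
Lemma amgm3 (R : rcfType) (a x y : R) : 0 <= a -> 0 < x -> 0 < y ->
  3 * a ^+ 2 <= x * y + a ^+ 3 / x + a ^+ 3 / y.
Proof.
move=> a0 x0 y0; have p0 : 0 < x * y by rewrite mulr_gt0.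
set t := Num.sqrt (x * y).
have t0 : 0 < t by rewrite sqrtr_gt0.
have t2 : t ^+ 2 = x * y by rewrite sqr_sqrtr // ltW.
have st : 2 * t <= x + y.
  have xy0 : 0 <= x + y by rewrite addr_ge0 ?ltW.
  have t20 : 0 <= 2 * t by rewrite mulr_ge0 ?ltW.
  rewrite -(ler_sqr t20 xy0) exprMn t2 -subr_ge0.
  by have -> : (x + y) ^+ 2 - 2 ^+ 2 * (x * y) = (x - y) ^+ 2;
    [ring | exact: sqr_ge0].
have -> : x * y + a ^+ 3 / x + a ^+ 3 / y =
    ((x * y) ^+ 2 + a ^+ 3 * (x + y)) / (x * y) by field; rewrite !gt_eqF.
rewrite ler_pdivlMr // -t2.
have a3 : 0 <= a ^+ 3 by rewrite exprn_ge0.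
have h1 : a ^+ 3 * (2 * t) <= a ^+ 3 * (x + y) by rewrite ler_wpM2l.
(* This product is [t^4 - 3 a^2 t^2 + 2 a^3 t], the inequality left once [x + y] is replaced by
   [2 t]. *)
have h2 : 0 <= t * (t - a) ^+ 2 * (t + 2 * a).
  have ta0 : 0 <= t + 2 * a by rewrite addr_ge0 ?mulr_ge0 ?(ltW t0).
  by rewrite mulr_ge0 // mulr_ge0 ?sqr_ge0 // ltW.
have -> : (t ^+ 2) ^+ 2 + a ^+ 3 * (x + y) =
  3 * a ^+ 2 * t ^+ 2 + t * (t - a) ^+ 2 * (t + 2 * a)
  + (a ^+ 3 * (x + y) - a ^+ 3 * (2 * t)) by ring.
lra.
Qed.

(* Taking [a] to be the average degree, this is the Blakley-Roy inequality for
   walks of length 3; it is linear in the number of edges for a fixed [a]. *)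
Lemma walks3_ge (R : rcfType) (T : finType) (h : rel T) (a : R) :
  symmetric h -> 0 <= a ->
  3 * a ^+ 2 * (\sum_x deg h x)%:R - 2 * a ^+ 3 * #|T|%:R <=
  (\sum_w \sum_u h w u * (deg h w * deg h u))%:R.
Proof.
move=> h_sym a0; pose r x : R := a ^+ 3 / (deg h x)%:R.
have rsum : \sum_w \sum_u (h w u)%:R * r w <= a ^+ 3 * #|T|%:R.
  rewrite mulr_natr -sumr_const; apply: ler_sum => w _.
  rewrite -mulr_suml -natr_sum -/(deg h w) /r.
  (* An isolated vertex contributes 0, any other exactly [a ^+ 3]. *)
  have [->|d0] := eqVneq (deg h w) 0%N; first by rewrite mul0r exprn_ge0.
  by rewrite mulrCA mulfV ?mulr1 // pnatr_eq0.
have rsum' : \sum_w \sum_u (h w u)%:R * r u = \sum_w \sum_u (h w u)%:R * r w.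
  rewrite exchange_big /=; apply: eq_bigr => u _; apply: eq_bigr => w _.
  by rewrite h_sym.
have dsum : \sum_w \sum_u (h w u)%:R * (3 * a ^+ 2) =
    3 * a ^+ 2 * (\sum_x deg h x)%:R :> R.
  rewrite [RHS]mulrC natr_sum mulr_suml; apply: eq_bigr => w _.
  by rewrite natr_sum mulr_suml.
suff : \sum_w \sum_u (h w u)%:R * (3 * a ^+ 2) <=
    (\sum_w \sum_u h w u * (deg h w * deg h u))%:R +
    \sum_w \sum_u (h w u)%:R * r w + \sum_w \sum_u (h w u)%:R * r u.
  by rewrite dsum rsum'; lra.
rewrite natr_sum -!big_split /=; apply: ler_sum => w _.
rewrite natr_sum -!big_split /=; apply: ler_sum => u _.
rewrite natrM -!mulrDr; have [wu|_] := boolP (h w u); last by rewrite !mul0r.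
have dpos x y : h x y -> 0 < (deg h x)%:R :> R.
  by move=> xy; rewrite ltr0n /deg (bigD1 y) //= xy.
rewrite !mul1r natrM; apply: amgm3 => //; first exact: dpos wu.
by apply: (dpos _ w); rewrite h_sym.
Qed.

Lemma ex_K3_C5_le (R : rcfType) (n : nat) : (0 < n)%N ->
  (ex_K3_C5 n)%:R <= Num.sqrt (n%:R / 2) ^+ 3 + 9 / 4 * n%:R :> R.
Proof.
move=> n0; set a := Num.sqrt _.
have a0 : 0 <= a by apply: sqrtr_ge0.
have a2 : a ^+ 2 = n%:R / 2 by rewrite sqr_sqrtr // divr_ge0.
rewrite /ex_K3_C5; apply: (big_ind (fun m : nat => m%:R <= a ^+ 3 + 9 / 4 * n%:R)).
- by rewrite addr_ge0 ?mulr_ge0 ?exprn_ge0 // divr_ge0.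
- by move=> m p mB pB; rewrite /maxn; case: ifP.
move=> E /andP[sE cE].
have [h [h_sym h_irr h_C4 h_C5 tM]] := triangles_le_edges sE cE.
rewrite -/(\sum_x deg h x)%N in tM; set M := (\sum_x deg h x)%N in tM.
have up := walks3_le h_sym h_irr h_C4 h_C5; have := walks3_ge h_sym a0.
set W := (\sum_w _)%N in up * => low; rewrite -/M card_ord in up low.
move: up tM; rewrite -!(ler_nat R) !natrD !natrM => up tM.
have n0' : 0 < n%:R :> R by rewrite ltr0n.
(* With [a^2 = n/2] the two bounds on [W] give [3 n M - 4 a^3 n <= n M + 9 n^2]; the number of
   triangles is at most [M / 2]. *)
suff : M%:R <= 2 * a ^+ 3 + 9 / 2 * n%:R :> R by lra.
rewrite -(ler_pM2l n0'); rewrite a2 in low; nra.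
Qed.

Theorem theorem1 (R : realType) :
  exists eps : nat -> R,
    (eps n @[n --> \oo] --> (0 : R)) /\
    forall n : nat, (0 < n)%N ->
      (ex_K3_C5 n)%:R <=
        1 / (2 * Num.sqrt 2) * (1 + eps n) * (n%:R `^ (3 / 2)) :> R.
Proof.
(* Chosen so that the error term equals [9/4 n] exactly. *)
exists (fun n => 9 / 2 * Num.sqrt 2 / Num.sqrt n%:R); split.
  rewrite -(mulr0 (9 / 2 * Num.sqrt 2)); apply: cvgMl_tmp.
  under eq_fun do rewrite -sqrtrV //.
  have inv0 : (n%:R^-1 : R) @[n --> \oo] --> (0 : R).
    apply/gtr0_cvgV0; last exact: cvgr_idn.
    by near=> n; rewrite ltr0n; near: n; exact: nbhs_infty_gt.
  by have := cvg_comp _ _ inv0 (@sqrt_continuous R 0); rewrite sqrtr0.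
move=> n n0; have n0' : 0 < n%:R :> R by rewrite ltr0n.
have -> : n%:R `^ (3 / 2) = n%:R * Num.sqrt n%:R :> R.
  have -> : 3 / 2 = 1 + 2^-1 :> R by field.
  by rewrite powRD ?gt_eqF ?implybT // powRr1 ?ltW // powR12_sqrt ?ltW.
apply: le_trans (ex_K3_C5_le R n0) _.
have -> : Num.sqrt (n%:R / 2) = Num.sqrt n%:R / Num.sqrt 2 :> R.
  by rewrite sqrtrM ?ltW // sqrtrV.
have s0 : 0 < Num.sqrt n%:R :> R by rewrite sqrtr_gt0.
have t0 : 0 < Num.sqrt 2 :> R by rewrite sqrtr_gt0.
have t2 : Num.sqrt 2 ^+ 2 = 2 :> R by rewrite sqr_sqrtr.
set t := Num.sqrt 2 in t0 t2 *.
have s2 := sqr_sqrtr (ltW n0'); set s := Num.sqrt n%:R in s0 s2 *; rewrite -s2.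
have -> : (s / t) ^+ 3 = s ^+ 3 / (2 * t) by rewrite expr_div_n [t ^+ 3]exprSr t2.
by rewrite le_eqVlt; apply/orP; left; apply/eqP; field; rewrite !gt_eqF.
Unshelve. all: by end_near. Qed.
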